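(* Let $\zeta=e^{2\pi i/3}$, let $a=-2^{1/3}$ (the real number with $a^3=-2$), and let $m_1,\dots,m_{18}$ be the following $3\times 3$ complex matrices: $$m_1=\begin{pmatrix}1&-1&0\\-1&1&0\\0&0&0\end{pmatrix},\quad m_2=\begin{pmatrix}0&0&0\\0&1&-\zeta\\0&-\zeta^2&1\end{pmatrix},\quad m_3=\begin{pmatrix}1&0&-\zeta\\0&0&0\\-\zeta^2&0&1\end{pmatrix},$$ $$m_4=\begin{pmatrix}0&0&0\\0&1&-\zeta^2\\0&-\zeta&1\end{pmatrix},\quad m_5=\begin{pmatrix}1&0&-1\\0&0&0\\-1&0&1\end{pmatrix},\quad m_6=\begin{pmatrix}1&-\zeta&0\\-\zeta^2&1&0\\0&0&0\end{pmatrix},$$ $$m_7=\begin{pmatrix}1&0&-\zeta^2\\0&0&0\\-\zeta&0&1\end{pmatrix},\quad m_8=\begin{pmatrix}1&-\zeta^2&0\\-\zeta&1&0\\0&0&0\end{pmatrix},\quad m_9=\begin{pmatrix}0&0&0\\0&1&-1\\0&-1&1\end{pmatrix},$$ $$m_{10}=\begin{pmatrix}a&0&0\\0&a&0\\0&0&a\end{pmatrix},\quad m_{11}=\begin{pmatrix}0&1&0\\0&0&\zeta\\\zeta^2&0&0\end{pmatrix},\quad m_{12}=\begin{pmatrix}0&0&1\\\zeta^2&0&0\\0&\zeta&0\end{pmatrix},$$ $$m_{13}=\begin{pmatrix}0&1&0\\0&0&\zeta^2\\\zeta&0&0\end{pmatrix},\quad m_{14}=\begin{pmatrix}0&0&1\\1&0&0\\0&1&0\end{pmatrix},\quad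 m_{15}=\begin{pmatrix}1&0&0\\0&\zeta&0\\0&0&\zeta^2\end{pmatrix},$$ $$m_{16}=\begin{pmatrix}0&0&1\\\zeta&0&0\\0&\zeta^2&0\end{pmatrix},\quad m_{17}=\begin{pmatrix}1&0&0\\0&\zeta^2&0\\0&0&\zeta\end{pmatrix},\quad m_{18}=\begin{pmatrix}0&1&0\\0&0&1\\1&0&0\end{pmatrix}.$$ Then $$sM_{\langle 3\rangle}=\frac16\sum_{i=1}^{18}m_i^{(3)}.$$ That is, the $m_i$ form a rank 18 Waring decomposition of $6\,sM_{\langle 3\rangle}$ (an expression of it as a sum of 18 cubes).
   Context: Let $V=\mathbb{C}^3$ and identify $V^\ast\otimes V$ with the space of $3\times 3$ complex matrices. The symmetrized matrix multiplication tensor $sM_{\langle 3\rangle}\in S^3(V^\ast\otimes V)$ is the symmetric tensor corresponding to the symmetric trilinear form $(A,B,C)\mapsto\frac12(\operatorname{tr}(ABC)+\operatorname{tr}(ACB))$ on $3\times3$ matrices, where $V^\ast\otimes V$ is identified with its dual through the trace pairing $(X,Y)\mapsto\operatorname{tr}(XY)$. For a matrix $m$, $m^{(3)}$ denotes its symmetric cube $m\otimes m\otimes m\in S^3(V^\ast\otimes V)$, which under this identification corresponds to the trilinear form $(A,B,C)\mapsto\operatorname{tr}(mA)\operatorname{tr}(mB)\operatorname{tr}(mC)$. A Waring decomposition of rank $r$ of a symmetric tensor is an expression of it as a sum of $r$ such cubes. *)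

(* Defs.v *)
From HB Require Import structures.
From mathcomp Require Import all_boot all_order all_algebra.
From mathcomp Require Import reals exp trigo.
From mathcomp Require Import complex mxtens.

Set Implicit Arguments.
Unset Strict Implicit.
Unset Printing Implicit Defensive.

Import Order.TTheory GRing.Theory Num.Theory.

Local Open Scope ring_scope.

(** The space of n x n matrices is written M. The Kronecker product realizes
    M (x) M (x) M as 'M_(n * n * n), the decomposable tensor A (x) B (x) C being
    A *t B *t C. *)

Section CubicTensors.
Variables (F : fieldType) (n : nat).

Local Notation M := 'M[F]_n.

Definition tensor3 := 'M[F]_(n * n * n).

Definition unitmat (p : 'I_n * 'I_n) : M := delta_mx p.1 p.2.

(** Coefficient of [T] on [unitmat p (x) unitmat q (x) unitmat r]. *)
Definition tcoord (T : tensor3) (p q r : 'I_n * 'I_n) : F :=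
  T (mxtens_index (mxtens_index (p.1, q.1), r.1))
    (mxtens_index (mxtens_index (p.2, q.2), r.2)).

(** Membership in S^3 M: the two transpositions generate the symmetric group
    permuting the three tensor factors. *)
Definition symmetric_tensor (T : tensor3) : Prop :=
  forall p q r, tcoord T q p r = tcoord T p q r /\ tcoord T p r q = tcoord T p q r.

Definition cube (m : M) : tensor3 := m *t m *t m.

(** The trilinear form of a tensor, M being identified with its dual through
    (X, Y) |-> \tr (X *m Y): by [form_of_tens], A' (x) B' (x) C' is sent to
    (A, B, C) |-> \tr (A' *m A) * \tr (B' *m B) * \tr (C' *m C). *)
Definition form_of (T : tensor3) (A B C : M) : F := \tr (T *m (A *t B *t C)).

(** Inverse of [form_of] on trilinear forms: the basis dual to [unitmat] for the
    trace pairing consists of the transposed matrix units. *)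
Definition tensor_of (f : M -> M -> M -> F) : tensor3 :=
  \sum_p \sum_q \sum_r
    f (unitmat p)^T (unitmat q)^T (unitmat r)^T
      *: (unitmat p *t unitmat q *t unitmat r).

Definition sM_form (A B C : M) : F :=
  2%:R^-1 * (\tr (A *m B *m C) + \tr (A *m C *m B)).

Definition sM : tensor3 := tensor_of sM_form.

Definition waring_decomposition (r : nat) (T : tensor3) (m : 'I_r -> M) : Prop :=
  symmetric_tensor T /\ T = \sum_(i < r) cube (m i).

Lemma tcoord_tens (A B C : M) p q r :
  tcoord (A *t B *t C) p q r = A p.1 p.2 * B q.1 q.2 * C r.1 r.2.
Proof. by rewrite /tcoord !tensmxE. Qed.

Lemma tcoordP (S T : tensor3) :
  (forall p q r, tcoord S p q r = tcoord T p q r) -> S = T.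
Proof.
move=> h; apply/matrixP=> i j.
case: (mxtens_indexP i) => i1 i2; case: (mxtens_indexP i1) => i3 i4.
case: (mxtens_indexP j) => j1 j2; case: (mxtens_indexP j1) => j3 j4.
exact: (h (i3, j3) (i4, j4) (i2, j2)).
Qed.

Lemma unitmatE p q : unitmat p q.1 q.2 = (p == q)%:R.
Proof.
by case: p q => [? ?] [? ?]; rewrite mxE /= eq_sym [X in _ && X]eq_sym.
Qed.

Lemma tcoord_sum (I : finType) (T : I -> tensor3) p q r :
  tcoord (\sum_i T i) p q r = \sum_i tcoord (T i) p q r.
Proof. by rewrite /tcoord summxE. Qed.

Lemma tcoord_tensor_of f p q r :
  tcoord (tensor_of f) p q r = f (unitmat p)^T (unitmat q)^T (unitmat r)^T.
Proof.
have E p' q' r' :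
    tcoord (f (unitmat p')^T (unitmat q')^T (unitmat r')^T
      *: (unitmat p' *t unitmat q' *t unitmat r')) p q r
    = f (unitmat p')^T (unitmat q')^T (unitmat r')^T
      * ((p' == p)%:R * (q' == q)%:R * (r' == r)%:R).
  by rewrite {1}/tcoord mxE -/(tcoord _ p q r) tcoord_tens !unitmatE.
rewrite tcoord_sum (bigD1 p) //= [X in _ + X]big1 ?addr0 => [|p' ne]; last first.
  rewrite tcoord_sum big1 // => q' _; rewrite tcoord_sum big1 // => r' _.
  by rewrite E (negPf ne) !mul0r mulr0.
rewrite tcoord_sum (bigD1 q) //= [X in _ + X]big1 ?addr0 => [|q' ne]; last first.
  rewrite tcoord_sum big1 // => r' _.
  by rewrite E (negPf ne) mulr0 mul0r mulr0.
rewrite tcoord_sum (bigD1 r) //= [X in _ + X]big1 ?addr0 => [|r' ne]; last first.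
  by rewrite E (negPf ne) !mulr0.
by rewrite E !eqxx !mulr1.
Qed.

Lemma mxtrace_tens k l (A : 'M[F]_k) (B : 'M[F]_l) :
  \tr (A *t B) = \tr A * \tr B.
Proof.
rewrite /mxtrace big_distrl /=.
under [RHS]eq_bigr => i _ do rewrite big_distrr /=.
rewrite pair_big /= (reindex (@mxtens_index k l)) /=; last first.
  by apply: onW_bij; exists (@mxtens_unindex k l);
    [exact: mxtens_indexK | exact: mxtens_unindexK].
by apply: eq_bigr => -[i j] _; rewrite tensmxE.
Qed.

Lemma form_of_tens (A' B' C' A B C : M) :
  form_of (A' *t B' *t C') A B C =
  \tr (A' *m A) * \tr (B' *m B) * \tr (C' *m C).
Proof. by rewrite /form_of !tensmx_mul !mxtrace_tens. Qed.

Lemma form_of_cube (m A B C : M) :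
  form_of (cube m) A B C = \tr (m *m A) * \tr (m *m B) * \tr (m *m C).
Proof. exact: form_of_tens. Qed.

Lemma mxtrace_unitmat p (A : M) : \tr (unitmat p *m A) = A p.2 p.1.
Proof.
rewrite /mxtrace (bigD1 p.1) //= [X in _ + X]big1 ?addr0 => [|i ne].
  rewrite mxE (bigD1 p.2) //= big1 ?addr0 => [|j ne]; rewrite mxE ?eqxx ?mul1r//.
  by rewrite (negPf ne) andbF mul0r.
by rewrite mxE big1 // => j _; rewrite mxE (negPf ne) mul0r.
Qed.

Lemma unitmat_expand (A : M) : A = \sum_p A p.2 p.1 *: (unitmat p)^T.
Proof.
rewrite {1}[A]matrix_sum_delta exchange_big pair_big /=.
by apply: eq_bigr => p _; rewrite /unitmat trmx_delta.
Qed.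

Lemma form_of_tensor_of f :
  (forall B C, linear (fun A => f A B C : F^o)) ->
  (forall A C, linear (fun B => f A B C : F^o)) ->
  (forall A B, linear (fun C => f A B C : F^o)) ->
  forall A B C, form_of (tensor_of f) A B C = f A B C.
Proof.
move=> l1 l2 l3 A B C.
have ls (g : M -> F^o) : linear g -> forall (h : 'I_n * 'I_n -> F) X,
    g (\sum_p h p *: X p) = \sum_p h p * g (X p).
  move=> lg h X; have g0 : g 0 = 0.
    by have := lg (-1) 0 0; rewrite scaler0 addr0 scaleN1r addNr.
  elim/big_rec2: _ => // p y x _ IH.
  by rewrite lg IH.
rewrite {2}[A]unitmat_expand (ls _ (l1 B C)) /form_of /tensor_of.
rewrite mulmx_suml raddf_sum; apply: eq_bigr => p _ /=.
rewrite {2}[B]unitmat_expand (ls _ (l2 _ C)) mulmx_suml raddf_sum mulr_sumr.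
apply: eq_bigr => q _ /=.
rewrite {2}[C]unitmat_expand (ls _ (l3 _ _)) mulmx_suml raddf_sum !mulr_sumr.
apply: eq_bigr => r _ /=.
rewrite -scalemxAl mxtraceZ -/(form_of _ A B C) form_of_tens !mxtrace_unitmat.
by rewrite mulrC !mulrA.
Qed.

Lemma form_of_unitmat T p q r :
  form_of T (unitmat p)^T (unitmat q)^T (unitmat r)^T = tcoord T p q r.
Proof.
rewrite /form_of mxtrace_mulC /tcoord /mxtrace.
have E i j k i' j' k' : ((unitmat p)^T *t (unitmat q)^T *t (unitmat r)^T)
    (mxtens_index (mxtens_index (i, j), k))
    (mxtens_index (mxtens_index (i', j'), k')) =
    (((i', i) == p) && ((j', j) == q) && ((k', k) == r))%:R :> F.
  rewrite !tensmxE !mxE -!natrM !mulnb.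
  by case: p q r => [? ?] [? ?] [? ?] /=; rewrite -!pair_eqE.
rewrite (bigD1 (mxtens_index (mxtens_index (p.2, q.2), r.2))) //=.
rewrite [X in _ + X]big1 ?addr0 => [|i]; rewrite mxE.
  rewrite (bigD1 (mxtens_index (mxtens_index (p.1, q.1), r.1))) //=.
  rewrite E -!surjective_pairing !eqxx mul1r big1 ?addr0 // => j.
  case: (mxtens_indexP j) => j1 j2; case: (mxtens_indexP j1) => j3 j4 ne.
  rewrite E; case: eqP => [e1|_]; last by rewrite mul0r.
  case: eqP => [e2|_]; last by rewrite mul0r.
  case: eqP => [e3|_]; last by rewrite mul0r.
  by move: ne; rewrite -e1 -e2 -e3 eqxx.
case: (mxtens_indexP i) => j1 j2; case: (mxtens_indexP j1) => j3 j4 ne.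
apply: big1 => k _; case: (mxtens_indexP k) => k1 k2.
case: (mxtens_indexP k1) => k3 k4.
rewrite E; case: eqP => [e1|_]; last by rewrite mul0r.
case: eqP => [e2|_]; last by rewrite mul0r.
case: eqP => [e3|_]; last by rewrite mul0r.
by move: ne; rewrite -e1 -e2 -e3 eqxx.
Qed.

Lemma form_of_inj S T :
  (forall A B C, form_of S A B C = form_of T A B C) -> S = T.
Proof. by move=> h; apply: tcoordP => p q r; rewrite -!form_of_unitmat h. Qed.

Lemma form_of_sM A B C : form_of sM A B C = sM_form A B C.
Proof.
apply: form_of_tensor_of => {A B C} X Y k U V; rewrite /sM_form;
  rewrite !(mulmxDl, mulmxDr) -?scalemxAr -?scalemxAl -?scalemxAr;
  rewrite -?scalemxAl !mxtraceD !mxtraceZ;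
  by rewrite addrACA mulrDr -[X in _ * X + _]mulrDr mulrCA.
Qed.

Lemma symmetric_sM : symmetric_tensor sM.
Proof.
move=> p q r; rewrite !tcoord_tensor_of /sM_form; split; congr (_ * _).
  rewrite addrC; congr (_ + _).
    by rewrite mxtrace_mulC mulmxA.
  by rewrite -mulmxA mxtrace_mulC.
by rewrite addrC.
Qed.

Lemma symmetric_cube m : symmetric_tensor (cube m).
Proof.
by move=> p q r; rewrite !tcoord_tens; split; [rewrite [m q.1 _ * _]mulrC | rewrite mulrAC].
Qed.

End CubicTensors.

Definition mx3 (T : nzRingType) (rows : seq (seq T)) : 'M[T]_3 :=
  \matrix_(i < 3, j < 3) nth 0 (nth [::] rows i) j.

Section Matrices.
Variable R : realType.

Local Notation C := R[i].

Definition zeta : C := (cos (2 * pi / 3) +i* sin (2 * pi / 3))%C.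

Definition a : C := (- (2 `^ 3^-1))%:C%C.

Local Notation z := zeta.

Definition ms : seq 'M[C]_3 := [::
  mx3 [:: [:: 1; -1; 0]; [:: -1; 1; 0]; [:: 0; 0; 0]];
  mx3 [:: [:: 0; 0; 0]; [:: 0; 1; - z]; [:: 0; - z ^+ 2; 1]];
  mx3 [:: [:: 1; 0; - z]; [:: 0; 0; 0]; [:: - z ^+ 2; 0; 1]];
  mx3 [:: [:: 0; 0; 0]; [:: 0; 1; - z ^+ 2]; [:: 0; - z; 1]];
  mx3 [:: [:: 1; 0; -1]; [:: 0; 0; 0]; [:: -1; 0; 1]];
  mx3 [:: [:: 1; - z; 0]; [:: - z ^+ 2; 1; 0]; [:: 0; 0; 0]];
  mx3 [:: [:: 1; 0; - z ^+ 2]; [:: 0; 0; 0]; [:: - z; 0; 1]];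
  mx3 [:: [:: 1; - z ^+ 2; 0]; [:: - z; 1; 0]; [:: 0; 0; 0]];
  mx3 [:: [:: 0; 0; 0]; [:: 0; 1; -1]; [:: 0; -1; 1]];
  mx3 [:: [:: a; 0; 0]; [:: 0; a; 0]; [:: 0; 0; a]];
  mx3 [:: [:: 0; 1; 0]; [:: 0; 0; z]; [:: z ^+ 2; 0; 0]];
  mx3 [:: [:: 0; 0; 1]; [:: z ^+ 2; 0; 0]; [:: 0; z; 0]];
  mx3 [:: [:: 0; 1; 0]; [:: 0; 0; z ^+ 2]; [:: z; 0; 0]];
  mx3 [:: [:: 0; 0; 1]; [:: 1; 0; 0]; [:: 0; 1; 0]];
  mx3 [:: [:: 1; 0; 0]; [:: 0; z; 0]; [:: 0; 0; z ^+ 2]];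
  mx3 [:: [:: 0; 0; 1]; [:: z; 0; 0]; [:: 0; z ^+ 2; 0]];
  mx3 [:: [:: 1; 0; 0]; [:: 0; z ^+ 2; 0]; [:: 0; 0; z]];
  mx3 [:: [:: 0; 1; 0]; [:: 0; 0; 1]; [:: 1; 0; 0]] ].

(** 0-based: [m i] is the (i + 1)-st of the eighteen matrices. *)
Definition m (i : 'I_18) : 'M[C]_3 := nth 0 ms i.

End Matrices.

(* Main.v *)
Require Import Defs.
From mathcomp Require Import all_boot all_order all_algebra.
From mathcomp Require Import reals.
From mathcomp Require Import complex.
From mathcomp Require Import mxtens exp trigo ring lra.

Import Order.TTheory GRing.Theory Num.Theory.

(** All the matrices but [m_10] = a I have entries in Z[zeta], and
    a ^ 3 = -2 turns [m_10]^(3) into -2 I^(3). The identity is thus one in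
    Z[zeta] for each of the 9 ^ 3 coordinates, and is checked by computing with
    pairs of integers. *)

Local Open Scope ring_scope.

(** The pair (x, y) stands for x + y * zeta in Z[X] / (X ^ 2 + X + 1). *)
Definition eisenstein := (int * int)%type.

Definition eis_add (u v : eisenstein) : eisenstein := (u.1 + v.1, u.2 + v.2).

Definition eis_mul (u v : eisenstein) : eisenstein :=
  (u.1 * v.1 - u.2 * v.2, u.1 * v.2 + u.2 * v.1 - u.2 * v.2).

Definition eis_eval (F : nzRingType) (z : F) (u : eisenstein) : F :=
  u.1%:~R + u.2%:~R * z.

Lemma eis_evalD (F : nzRingType) (z : F) u v :
  eis_eval F z (eis_add u v) = eis_eval F z u + eis_eval F z v.
Proof. by rewrite /eis_eval /eis_add !intrD mulrDl addrACA. Qed.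

Lemma eis_evalM (F : comNzRingType) (z : F) u v :
  z ^+ 2 = - z - 1 ->
  eis_eval F z (eis_mul u v) = eis_eval F z u * eis_eval F z v.
Proof.
move=> z2; rewrite /eis_eval /eis_mul /= !(intrD, intrB, intrM).
by ring: z2.
Qed.

(** Indices become plain numbers, so that the final check evaluates without the proofs carried by
    ordinals. *)
Definition index_nat {n} (p : 'I_n * 'I_n) : nat * nat :=
  (p.1 : nat, p.2 : nat).

Definition eis_matrix := seq (seq eisenstein).

Definition eis_entry (A : eis_matrix) (p : nat * nat) : eisenstein :=
  nth (0, 0) (nth [::] A p.1) p.2.

Definition eis_mx (F : nzRingType) (z : F) (A : eis_matrix) : 'M[F]_3 :=
  mx3 [seq [seq eis_eval F z u | u <- row] | row <- A].

(** The two defaults agree: outside the lists [eis_entry] gives [(0, 0)], which evaluates to 0, the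
    default of [mx3]. *)
Lemma eis_mxE (F : nzRingType) (z : F) A (i j : 'I_3) :
  eis_mx F z A i j = eis_eval F z (eis_entry A (index_nat (i, j))).
Proof.
have e0 : eis_eval F z (0, 0) = 0 by rewrite /eis_eval /= mul0r addr0.
rewrite mxE /eis_entry /=.
have [iA|iA] := ltnP i (size A); last first.
  by rewrite [in RHS](nth_default [::]) // nth_nil e0
             (nth_default [::]) ?nth_nil // size_map.
rewrite (nth_map [::]) //; have [jA|jA] := ltnP j (size (nth [::] A i)).
  exact: nth_map.
by rewrite [in RHS]nth_default // e0 nth_default // size_map.
Qed.

(** * Integer models of the matrices *)

Section EisensteinMatrices.

Local Notation o := ((0, 0) : eisenstein).
Local Notation e := ((1, 0) : eisenstein).
Local Notation w := ((0, 1) : eisenstein).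
Local Notation w2 := ((-1, -1) : eisenstein).
Local Notation ne := ((-1, 0) : eisenstein).
Local Notation nw := ((0, -1) : eisenstein).
Local Notation nw2 := ((1, 1) : eisenstein).

(** The list breaks off at [m_10], which is not defined over Z[zeta]. The pair [w2] is zeta^2 = -1 -
    zeta. *)
Definition eis_ms1_9 : seq eis_matrix := [::
  [:: [:: e; ne; o]; [:: ne; e; o]; [:: o; o; o]];
  [:: [:: o; o; o]; [:: o; e; nw]; [:: o; nw2; e]];
  [:: [:: e; o; nw]; [:: o; o; o]; [:: nw2; o; e]];
  [:: [:: o; o; o]; [:: o; e; nw2]; [:: o; nw; e]];
  [:: [:: e; o; ne]; [:: o; o; o]; [:: ne; o; e]];
  [:: [:: e; nw; o]; [:: nw2; e; o]; [:: o; o; o]];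
  [:: [:: e; o; nw2]; [:: o; o; o]; [:: nw; o; e]];
  [:: [:: e; nw2; o]; [:: nw; e; o]; [:: o; o; o]];
  [:: [:: o; o; o]; [:: o; e; ne]; [:: o; ne; e]] ].

Definition eis_ms11_18 : seq eis_matrix := [::
  [:: [:: o; e; o]; [:: o; o; w]; [:: w2; o; o]];
  [:: [:: o; o; e]; [:: w2; o; o]; [:: o; w; o]];
  [:: [:: o; e; o]; [:: o; o; w2]; [:: w; o; o]];
  [:: [:: o; o; e]; [:: e; o; o]; [:: o; e; o]];
  [:: [:: e; o; o]; [:: o; w; o]; [:: o; o; w2]];
  [:: [:: o; o; e]; [:: w; o; o]; [:: o; w2; o]];
  [:: [:: e; o; o]; [:: o; w2; o]; [:: o; o; w]];
  [:: [:: o; e; o]; [:: o; o; e]; [:: e; o; o]] ].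

Definition eis_one : eis_matrix :=
  [:: [:: e; o; o]; [:: o; e; o]; [:: o; o; e]].

End EisensteinMatrices.

(** * The identity in Z[zeta] *)

Definition eis_cube (A : eis_matrix) (p q r : nat * nat) : eisenstein :=
  eis_mul (eis_mul (eis_entry A p) (eis_entry A q)) (eis_entry A r).

Definition eis_sum (s : seq eisenstein) : eisenstein := foldr eis_add (0, 0) s.

Lemma eis_eval_sum (F : nzRingType) (z : F) s :
  eis_eval F z (eis_sum s) = \sum_(u <- s) eis_eval F z u.
Proof.
elim: s => [|u s IHs]; first by rewrite big_nil /eis_eval /= mul0r addr0.
by rewrite big_cons -IHs -eis_evalD.
Qed.

Lemma tcoord_cube_eis_mx (F : fieldType) (z : F) A (p q r : 'I_3 * 'I_3) :
  z ^+ 2 = - z - 1 ->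
  tcoord (cube (eis_mx F z A)) p q r =
  eis_eval F z (eis_cube A (index_nat p) (index_nat q) (index_nat r)).
Proof. by move=> z2; rewrite tcoord_tens !eis_mxE !eis_evalM. Qed.

(** The transpose of the unit at (i, j) is the unit at (j, i). A product of three such units has
    trace 1 when neighbouring indices agree cyclically, and trace 0 otherwise. *)
Definition chained (p q r : nat * nat) : bool :=
  [&& p.1 == q.2, q.1 == r.2 & r.1 == p.2].

Lemma trace_units (F : fieldType) n (p q r : 'I_n * 'I_n) :
  \tr ((unitmat F p)^T *m (unitmat F q)^T *m (unitmat F r)^T) =
  (chained (index_nat p) (index_nat q) (index_nat r))%:R.
Proof.
rewrite /unitmat !trmx_delta mul_delta_mx_cond /chained /=.
have [pq|pq] /= := eqVneq p.1 q.2; last first.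
  by rewrite (negPf (pq : (p.1 : nat) != q.2)) mul0mx raddf0.
rewrite pq eqxx mulr1n mul_delta_mx_cond.
have [qr|qr] /= := eqVneq q.1 r.2; last first.
  by rewrite (negPf (qr : (q.1 : nat) != r.2)) raddf0.
rewrite qr eqxx mulr1n /mxtrace (bigD1 p.2) //= mxE eqxx big1 ?addr0.
  by rewrite eq_sym.
by move=> i ip; rewrite mxE (negPf ip).
Qed.

(** The factor -2 is a^3, contributed by [m_10]. *)
Definition eis_cubes (p q r : nat * nat) : eisenstein :=
  eis_sum (eis_mul (-2, 0) (eis_cube eis_one p q r) ::
           [seq eis_cube A p q r | A <- eis_ms1_9 ++ eis_ms11_18]).

(** A coordinate of 6 [sM]: the factor 3 is 6 times the 1/2 of [sM_form]. *)
Definition eis_trace (p q r : nat * nat) : eisenstein :=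
  ((3 * (chained p q r + chained p r q))%N%:Z, 0).

Lemma eis_cubesE (p q r : 'I_3 * 'I_3) :
  eis_cubes (index_nat p) (index_nat q) (index_nat r) =
  eis_trace (index_nat p) (index_nat q) (index_nat r).
Proof.
pose I := [seq (i, j) | i <- iota 0 3, j <- iota 0 3].
have I_all (s : 'I_3 * 'I_3) : index_nat s \in I.
  by apply: allpairs_f; rewrite mem_iota /=.
(* Ranging over the explicit list [I] turns the claim into a closed boolean, decided by
   evaluation. *)
have /allP/(_ _ (I_all p))/allP/(_ _ (I_all q))/allP/(_ _ (I_all r))/eqP // :
  all (fun p => all (fun q => all (fun r =>
    eis_cubes p q r == eis_trace p q r) I) I) I.
by vm_compute.
Qed.

(** * The constants zeta and a *)

Lemma zeta_sqr (R : realType) : zeta R ^+ 2 = - zeta R - 1.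
Proof.
rewrite /zeta; set t : R := 2 * pi / 3.
have s_gt0 : 0 < sin t by apply: sin_gt0_pi; have := pi_gt0 R; rewrite /t; lra.
have cs : cos t ^+ 2 + sin t ^+ 2 = 1 by exact: cos2Dsin2.
(* Since 2t = 2 pi - t, cos t = cos 2t. This is a quadratic equation in cos t with roots 1 and
   -1/2. *)
have c2 : cos t = cos t ^+ 2 *+ 2 - 1.
  rewrite -cos_mulr2n -[LHS]cosN -[LHS]cosD2pi; congr cos.
  by rewrite /t !mulr2n; field.
have c12 : cos t = - 2^-1.
  have : (cos t - 1) * (cos t + 2^-1) = 0 by move: c2; rewrite mulr2n; lra.
  move/eqP; rewrite mulf_eq0 => /orP[] /eqP; last by lra.
  (* The root 1 would force sin t = 0, against [s_gt0]. *)
  move=> c1; have : sin t ^+ 2 = 0 by nra.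
  by move/eqP; rewrite sqrf_eq0 gt_eqF.
apply/eqP; rewrite eq_complex /=; apply/andP; split; apply/eqP; nra.
Qed.

Lemma a_cube (R : realType) : a R ^+ 3 = - 2.
Proof.
have -> : - 2 = (- 2 : R)%:C%C :> R[i] by rewrite rmorphN rmorph_nat.
rewrite /a -rmorphXn /=; congr _%:C%C.
rewrite exprNn -[(_ `^ _) ^+ _]powR_mulrn ?powR_ge0 // -powRrM.
by rewrite mulVf ?pnatr_eq0 // powRr1 //; ring.
Qed.

Lemma ms_eis (R : realType) :
  ms R = [seq eis_mx _ (zeta R) A | A <- eis_ms1_9] ++
         a R *: eis_mx _ (zeta R) eis_one ::
         [seq eis_mx _ (zeta R) A | A <- eis_ms11_18].
Proof.
(* The constant term comes first, as in [eis_eval]. *)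
have z2 : zeta R ^+ 2 = -1 - zeta R by rewrite zeta_sqr addrC.
rewrite /ms /eis_mx /eis_one /eis_eval /= z2 opprB opprK.
rewrite !(mulr0z, mulr1z, mulrN1z, mul0r, mul1r, mulN1r, addr0, add0r).
rewrite [zeta R + 1]addrC; congr [:: _, _, _, _, _, _, _, _, _, _ & _].
by apply/matrixP => -[[|[|[]]] // ?] -[[|[|[]]] // ?];
  rewrite !mxE /= ?mulr0 ?mulr1.
Qed.

(** * From coordinates to tensors *)

Section Tcoord.
Variables (F : fieldType) (n : nat).
Implicit Types (S T : tensor3 F n) (p q r : 'I_n * 'I_n).

Lemma tcoordD S T p q r :
  tcoord (S + T) p q r = tcoord S p q r + tcoord T p q r.
Proof. by rewrite /tcoord mxE. Qed.

Lemma tcoordZ (c : F) T p q r : tcoord (c *: T) p q r = c * tcoord T p q r.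
Proof. by rewrite /tcoord mxE. Qed.

Lemma tcoord_sum_seq (I : Type) (s : seq I) (T : I -> tensor3 F n) p q r :
  tcoord (\sum_(i <- s) T i) p q r = \sum_(i <- s) tcoord (T i) p q r.
Proof. by rewrite /tcoord summxE. Qed.

End Tcoord.

Lemma cubeZ (F : fieldType) n (c : F) (A : 'M[F]_n) :
  cube (c *: A) = c ^+ 3 *: cube A.
Proof.
apply: tcoordP => p q r; rewrite tcoordZ !tcoord_tens !mxE.
by ring.
Qed.

Lemma sum_cubes (R : realType) :
  \sum_(i < 18) cube (m R i) = 6 *: sM R[i] 3.
Proof.
have z2 := zeta_sqr R.
have -> : \sum_(i < 18) cube (m R i) = \sum_(A <- ms R) cube A.
  by rewrite [RHS](big_nth 0) big_mkord.
rewrite ms_eis big_cat big_map (big_cons _ _ (a R *: _)) big_map /=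
  cubeZ a_cube.
(* The tenth term moves to the front and the other seventeen form one sum, as in [eis_cubes]. *)
rewrite addrCA -big_cat; apply: tcoordP => p q r.
transitivity (eis_eval _ (zeta R)
    (eis_cubes (index_nat p) (index_nat q) (index_nat r))).
  rewrite eis_eval_sum [RHS]big_cons big_map eis_evalM //.
  rewrite tcoordD tcoordZ tcoord_sum_seq tcoord_cube_eis_mx //.
  congr (_ * _ + _).
    by rewrite /eis_eval /= mul0r addr0.
  by apply: eq_bigr => A _; rewrite -tcoord_cube_eis_mx.
rewrite eis_cubesE tcoordZ tcoord_tensor_of /sM_form !trace_units.
rewrite /eis_eval /= mul0r addr0.
(* What remains is 3 (x + y) = 6 (1/2 (x + y)). *)
by rewrite -pmulrn natrM natrD; field.
Qed.

Theorem theorem1 (R : realType) :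
  sM R[i] 3 = 6%:R^-1 *: \sum_(i < 18) cube (m R i) /\
  waring_decomposition (6%:R *: sM R[i] 3) (m R).
Proof.
have nz6 : 6%:R != 0 :> R[i] by rewrite pnatr_eq0.
split; first by rewrite sum_cubes scalerA mulVf ?scale1r.
split; last by rewrite sum_cubes.
move=> p q r; have [h1 h2] := @symmetric_sM R[i] 3 p q r.
by rewrite !tcoordZ h1 h2.
Qed.
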